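(* Let $f$ be a bounded multivariate rational function on $\mathbb{R}^n$, and let $\{\mathbf{x}_k\}_{k=1}^{\infty} \subset \mathbb{R}^n$ be a sequence of vectors in the domain of $f$ with a cluster point $\mathbf{x}^* \in \mathbb{R}^n$. Suppose that the following hold on the tail of the sequence: (i) there is $\sigma > 0$ such that for all sufficiently large $k$, $f(\mathbf{x}_k) - f(\mathbf{x}_{k+1}) \ge \sigma \|\nabla f(\mathbf{x}_k)\| \, \|\mathbf{x}_{k+1} - \mathbf{x}_k\|$; (ii) for all sufficiently large $k$, $f(\mathbf{x}_k) = f(\mathbf{x}_{k+1})$ implies $\mathbf{x}_k = \mathbf{x}_{k+1}$; (iii) the set $\mathcal{O}_{\mathbf{x}^*}$ contains every cluster point of the sequence $\left\{ \frac{\mathbf{x}_k - \mathbf{x}^*}{\|\mathbf{x}_k - \mathbf{x}^*\|} \right\}_{k \in \mathbb{N}}$. Then $\mathbf{x}^*$ is the limit of $\{\mathbf{x}_k\}_{k=1}^{\infty}$.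
   Context: A multivariate rational function on $\mathbb{R}^n$ is a function $r = p/q$ with $p, q : \mathbb{R}^n \to \mathbb{R}$ multivariate polynomials; its domain is the set of all points of $\mathbb{R}^n$ at which $q \neq 0$ (no division by zero occurs). Bounded means bounded on this domain. The point $\mathbf{x}^*$ need not lie in the domain of $f$. Given a bounded multivariate rational function $f = p/q$ on $\mathbb{R}^n$ (with $q$ not identically zero) and a point $\mathbf{x}^* \in \mathbb{R}^n$, let $f_j(\mathbf{x})$ denote the $j$-th Maclaurin series coefficient, with respect to $t$, of the denominator $q(t\mathbf{x} + \mathbf{x}^* )$ of the rational function $(\mathbf{x}, t) \mapsto f(t\mathbf{x} + \mathbf{x}^* )$. Define $$\mathcal{O}_{\mathbf{x}^*} = \{\mathbf{x} \in \mathbb{R}^n : f_{n_{\min}}(\mathbf{x}) \neq 0\}, \qquad n_{\min} = \min\{ j \in \mathbb{Z}_{\ge 0} : \exists\, \mathbf{x} \in \mathbb{R}^n,\ f_j(\mathbf{x}) \neq 0 \}.$$ In (iii), the quotients are taken over those $k$ with $\mathbf{x}_k \neq \mathbf{x}^*$. $\|\cdot\|$ is the Euclidean norm. *)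

(* Defs.v *)
From mathcomp Require Import all_boot all_order all_algebra.
From mathcomp Require Import all_classical all_reals all_analysis.
(* mpoly is not imported: its notations clash with those of mathcomp-analysis. *)
From mathcomp Require mpoly.

Set Implicit Arguments.
Unset Strict Implicit.
Unset Printing Implicit Defensive.

Import Order.TTheory GRing.Theory Num.Theory.
Import numFieldNormedType.Exports.

Local Open Scope classical_set_scope.
Local Open Scope ring_scope.

Section Definitions.
Context {R : realType} {n : nat}.
Implicit Types (p q : mpoly.mpoly n R) (x y : 'rV[R]_n).

(* The library norm `|x| on 'rV[R]_n is the sup norm. *)
Definition enorm x : R := Num.sqrt (\sum_(i < n) x 0 i ^+ 2).

Definition polyfun p x : R := mpoly.meval (fun i => x 0 i) p.

(* Total extension of p / q: it takes the value 0 outside [ratdom q]. *)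
Definition ratfun p q x : R := polyfun p x / polyfun q x.

Definition ratdom q : set 'rV[R]_n := [set x | polyfun q x != 0].

Definition gradient (f : 'rV[R]_n -> R) x : 'rV[R]_n :=
  \row_(i < n) 'D_(delta_mx 0 i) f x.

(* f_j(x): the j-th Maclaurin coefficient of t |-> q (t x + xs). *)
Definition maclaurin_coef q xs (j : nat) x : R :=
  derive1n j (fun t : R => polyfun q (t *: x + xs)) 0 / j`!%:R.

(* The minimum exists as soon as q is not identically zero; 0 is a dummy default. *)
Definition n_min q xs : nat :=
  xget 0%N [set j | (exists x, maclaurin_coef q xs j x != 0) /\
                    forall i, (exists x, maclaurin_coef q xs i x != 0) ->
                              (j <= i)%N].

Definition Oset q xs : set 'rV[R]_n :=
  [set x | maclaurin_coef q xs (n_min q xs) x != 0].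

Definition direction xs x : 'rV[R]_n := (enorm (x - xs))^-1 *: (x - xs).

(* Restricting the filter to the indices k with x_k != xs: if there are only
   finitely many of them the restricted filter contains set0 and there is no
   cluster point. *)
Definition direction_cluster (xs : 'rV[R]_n) (x_ : nat -> 'rV[R]_n) :
    set 'rV[R]_n :=
  cluster (direction xs (x_ k) @[k --> within [set k | x_ k != xs] \oo]).

End Definitions.

(* Main.v *)
Require Import Defs.
From mathcomp Require Import all_boot all_order all_algebra.
From mathcomp Require Import all_classical all_reals all_analysis.
From mathcomp Require mpoly.
From mathcomp Require ordered_qelim qe_rcf.
From mathcomp Require Import ring lra.
Import Order.TTheory GRing.Theory Num.Theory.
Import numFieldNormedType.Exports.
Local Open Scope classical_set_scope.
Local Open Scope ring_scope.

(** Consecutive points are at distance at most a constant times the drop of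
    [Lam (f x_k - l)], where [l] is the limit of the nonincreasing sequence
    [f x_k] and [Lam] is nondecreasing and bounded below.  These drops telescope,
    so that once the sequence is close to its cluster point with [f x_k] close
    to [l] it cannot leave a small ball any more.

    The function [Lam] comes from a Kurdyka-Lojasiewicz inequality, proved for
    an arbitrary quotient of polynomials on the part of its domain that lies in
    a ball ([kurdyka_lojasiewicz]): if [f x = l + t] and [0 < s <= t] with [t]
    small, then [t - s <= |grad f x| * (Lam t - Lam s)].  Its proof only looks at
    points of the domain, so the denominator may vanish at the centre of the
    ball.

    To find [Lam], select on each level [l + s] a point [gam s] at which the
    squared norm of the gradient is minimal up to the factor 4 and the error
    [s ^ 2], in such a way that all coordinates of [gam s], and its squared
    slope, are semialgebraic functions of [s] ([steepest_curve]).  A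
    semialgebraic function of one variable is monotone near [0+]
    ([semialg_fun_monotone]), so the l1-length of [gam] between two levels is
    the increment of one bounded nondecreasing function [L].  As [f] grows along
    [gam] at a rate at most its slope, [t - s <= K * (L t - L s)] for every [K]
    above the slopes of [gam] on the levels from [s] to [t]
    ([level_gap_le_length]).  If the slope of [gam] is nondecreasing in the
    level, [K] is comparable with the slope at any point of level [t], and [Lam]
    is a multiple of [L]; if it is nonincreasing and nonzero, the slope is
    bounded below near [0+] and a linear [Lam] is enough.

    The two facts about semialgebraic sets that this uses, monotonicity and
    definable selection ([semialg_curve_selection]), rest on the closure of
    these sets under projection, that is on quantifier elimination for real
    closed fields ([semialg_exists]), and on the constant sign of a polynomial
    on each side of a point. *)

(** * Semialgebraic predicates and projection *)

Section Semialgebraic.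
Context {R : realType}.
Implicit Types (e : nat -> R) (A B : (nat -> R) -> Prop).

(** Points are infinite environments, so that predicates in any number of
    variables live in one type and quantifiers can be handled by shifting
    indices; by [semialg_support] only finitely many coordinates matter. *)
Inductive is_poly : ((nat -> R) -> R) -> Prop :=
| is_poly_var i : is_poly (fun e => e i)
| is_poly_cst c : is_poly (fun=> c)
| is_polyD f g : is_poly f -> is_poly g -> is_poly (fun e => f e + g e)
| is_polyM f g : is_poly f -> is_poly g -> is_poly (fun e => f e * g e).

Inductive semialg : ((nat -> R) -> Prop) -> Prop :=
| semialg_gt0 f : is_poly f -> semialg (fun e => 0 < f e)
| semialg_not A : semialg A -> semialg (fun e => ~ A e)
| semialg_and A B : semialg A -> semialg B -> semialg (fun e => A e /\ B e).

Lemma is_poly_ext f g : f =1 g -> is_poly f -> is_poly g.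
Proof. by move=> /funext ->. Qed.

Lemma semialg_ext A B : (forall e, A e <-> B e) -> semialg A -> semialg B.
Proof. by move=> AB; have -> : A = B by apply/funext => e; apply/propext. Qed.

Lemma is_polyN f : is_poly f -> is_poly (fun e => - f e).
Proof.
move=> fP; apply: (@is_poly_ext (fun e => -1 * f e)) => [e|].
  by rewrite mulN1r.
by apply: is_polyM => //; exact: is_poly_cst.
Qed.

Lemma is_polyB f g : is_poly f -> is_poly g -> is_poly (fun e => f e - g e).
Proof. by move=> fP gP; apply: is_polyD => //; exact: is_polyN. Qed.

Lemma is_polyX f n : is_poly f -> is_poly (fun e => f e ^+ n).
Proof.
move=> fP; elim: n => [|n IHn].
  by apply: (@is_poly_ext (fun=> 1)) => //; exact: is_poly_cst.
apply: (@is_poly_ext (fun e => f e * f e ^+ n)) => [e|]; first by rewrite exprS.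
exact: is_polyM.
Qed.

Lemma is_poly_sum (I : Type) (r : seq I) (P : pred I) (F : I -> (nat -> R) -> R) :
  (forall i, is_poly (F i)) -> is_poly (fun e => \sum_(i <- r | P i) F i e).
Proof.
move=> FP; elim: r => [|i r IHr].
  apply: (@is_poly_ext (fun=> 0)) => [e|]; last exact: is_poly_cst.
  by rewrite big_nil.
apply: (@is_poly_ext (fun e => (if P i then F i e else 0)
   + \sum_(j <- r | P j) F j e)) => [e|].
  by rewrite big_cons; case: (P i); rewrite ?add0r.
by apply: is_polyD => //; case: (P i) => //; exact: is_poly_cst.
Qed.

Lemma is_poly_subst (g : nat -> (nat -> R) -> R) f :
  (forall i, is_poly (g i)) -> is_poly f -> is_poly (fun e => f (g ^~ e)).
Proof.
move=> gP; elim=> [i|c|f1 f2 _ ? _ ?|f1 f2 _ ? _ ?]; first exact: gP.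
- exact: is_poly_cst.
- exact: is_polyD.
- exact: is_polyM.
Qed.

Lemma semialg_subst (g : nat -> (nat -> R) -> R) A :
  (forall i, is_poly (g i)) -> semialg A -> semialg (fun e => A (g ^~ e)).
Proof.
move=> gP; elim=> [f fP|B _ BP|B C _ BP _ CP].
- exact/semialg_gt0/is_poly_subst.
- exact: semialg_not.
- exact: semialg_and.
Qed.

Lemma semialg_or A B : semialg A -> semialg B -> semialg (fun e => A e \/ B e).
Proof.
move=> AP BP; apply: (@semialg_ext (fun e => ~ (~ A e /\ ~ B e))) => [e|].
  by rewrite not_andE !notE.
by apply: semialg_not; apply: semialg_and; exact: semialg_not.
Qed.

Lemma semialg_imp A B : semialg A -> semialg B -> semialg (fun e => A e -> B e).
Proof.
move=> AP BP; apply: (@semialg_ext (fun e => ~ A e \/ B e)) => [e|].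
  by rewrite implyE.
by apply: semialg_or => //; exact: semialg_not.
Qed.

Lemma semialg_lt f g : is_poly f -> is_poly g -> semialg (fun e => f e < g e).
Proof.
move=> fP gP; apply: (@semialg_ext (fun e => 0 < g e - f e)) => [e|].
  by rewrite subr_gt0.
exact/semialg_gt0/is_polyB.
Qed.

Lemma semialg_le f g : is_poly f -> is_poly g -> semialg (fun e => f e <= g e).
Proof.
move=> fP gP; apply: (@semialg_ext (fun e => ~ (g e < f e))) => [e|].
  by rewrite leNgt; split=> /negP.
exact/semialg_not/semialg_lt.
Qed.

Lemma semialg_eq f g : is_poly f -> is_poly g -> semialg (fun e => f e = g e).
Proof.
move=> fP gP; apply: (@semialg_ext (fun e => f e <= g e /\ g e <= f e)) => [e|].
  by split=> [[fg gf]|->] //; apply/eqP; rewrite eq_le fg gf.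
by apply: semialg_and; exact: semialg_le.
Qed.

Lemma is_poly_term {f} : is_poly f -> exists t N, GRing.rterm t /\
  forall (s : seq R) e, (forall i, (i < N)%N -> s`_i = e i) ->
    GRing.eval s t = f e.
Proof.
elim=> [i|c|f1 f2 _ [t1 [N1 [r1 h1]]] _ [t2 [N2 [r2 h2]]]
  |f1 f2 _ [t1 [N1 [r1 h1]]] _ [t2 [N2 [r2 h2]]]].
- by exists (GRing.Var R i), i.+1; split=> // s e; apply.
- by exists (GRing.Const c), 0%N.
- exists (GRing.Add t1 t2), (maxn N1 N2); split=> [|s e se] /=; first by rewrite r1.
  by rewrite (h1 _ e) ?(h2 _ e) // => i iN; apply: se; rewrite leq_max iN ?orbT.
- exists (GRing.Mul t1 t2), (maxn N1 N2); split=> [|s e se] /=; first by rewrite r1.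
  by rewrite (h1 _ e) ?(h2 _ e) // => i iN; apply: se; rewrite leq_max iN ?orbT.
Qed.

Lemma semialg_formula {A} : semialg A -> exists phi N,
  ordered_qelim.ord.rformula phi /\
  forall (s : seq R) e, (forall i, (i < N)%N -> s`_i = e i) ->
    (ordered_qelim.ord.holds s phi <-> A e).
Proof.
elim=> [f fP|B _ [phi [N [rp h]]]|B C _ [p1 [N1 [r1 h1]]] _ [p2 [N2 [r2 h2]]]].
- have [t [N [rt h]]] := is_poly_term fP.
  exists (ordered_qelim.ord.Lt (GRing.NatConst _ 0) t), N; split=> //= s e se.
  by rewrite (h _ _ se).
- exists (ordered_qelim.ord.Not phi), N; split=> //= s e se.
  by rewrite (h _ _ se).
- exists (ordered_qelim.ord.And p1 p2), (maxn N1 N2); split=> /= [|s e se].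
    by rewrite r1.
  by rewrite (h1 _ e) ?(h2 _ e) // => i iN; apply: se; rewrite leq_max iN ?orbT.
Qed.

Lemma semialg_support {A} : semialg A -> exists N, forall e e',
  (forall i, (i < N)%N -> e i = e' i) -> A e <-> A e'.
Proof.
move=> /semialg_formula[phi [N [_ h]]]; exists N => e e' ee'.
rewrite -(h (mkseq e N)) => [|i iN]; last by rewrite nth_mkseq.
by rewrite -(h (mkseq e N)) // => i iN; rewrite nth_mkseq // ee'.
Qed.

Lemma rterm_is_poly (t : GRing.term R) : GRing.rterm t ->
  exists2 f, is_poly f & forall s : seq R, GRing.eval s t = f (nth 0 s).
Proof.
elim: t => //= [i|c|n|t1 IH1 t2 IH2|t IH|t IH n|t1 IH1 t2 IH2|t IH n].
- by exists (fun e => e i) => //; exact: is_poly_var.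
- by exists (fun=> c) => //; exact: is_poly_cst.
- by exists (fun=> n%:R) => //; exact: is_poly_cst.
- move=> /andP[/IH1[f fP fE] /IH2[g gP gE]].
  by exists (fun e => f e + g e) => [|s]; [exact: is_polyD|rewrite fE gE].
- move=> /IH[f fP fE].
  by exists (fun e => - f e) => [|s]; [exact: is_polyN|rewrite fE].
- move=> /IH[f fP fE].
  exists (fun e => f e * n%:R) => [|s]; last by rewrite fE mulr_natr.
  by apply: is_polyM => //; exact: is_poly_cst.
- move=> /andP[/IH1[f fP fE] /IH2[g gP gE]].
  by exists (fun e => f e * g e) => [|s]; [exact: is_polyM|rewrite fE gE].
- move=> /IH[f fP fE].
  by exists (fun e => f e ^+ n) => [|s]; [exact: is_polyX|rewrite fE].
Qed.

Lemma qf_form_semialg {phi : ordered_qelim.ord.formula R} :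
  ordered_qelim.ord.qf_form phi -> ordered_qelim.ord.rformula phi ->
  exists2 A, semialg A &
    forall s : seq R, ordered_qelim.ord.holds s phi <-> A (nth 0 s).
Proof.
elim: phi => //= [b|t u|t u|t u|p IHp r IHr|p IHp r IHr|p IHp r IHr|p IHp].
- move=> _ _; exists (fun=> (0 : R) < b%:R) => [|s].
    exact/semialg_gt0/is_poly_cst.
  by rewrite ltr0n lt0b.
- move=> _ /andP[/rterm_is_poly[f fP fE] /rterm_is_poly[g gP gE]].
  by exists (fun e => f e = g e) => [|s]; [exact: semialg_eq|rewrite fE gE].
- move=> _ /andP[/rterm_is_poly[f fP fE] /rterm_is_poly[g gP gE]].
  by exists (fun e => f e < g e) => [|s]; [exact: semialg_lt|rewrite fE gE].
- move=> _ /andP[/rterm_is_poly[f fP fE] /rterm_is_poly[g gP gE]].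
  by exists (fun e => f e <= g e) => [|s]; [exact: semialg_le|rewrite fE gE].
- move=> /andP[qp qr] /andP[rp rr]; have [A AP AE] := IHp qp rp.
  have [B BP BE] := IHr qr rr; exists (fun e => A e /\ B e) => [|s].
    exact: semialg_and.
  by rewrite AE BE.
- move=> /andP[qp qr] /andP[rp rr]; have [A AP AE] := IHp qp rp.
  have [B BP BE] := IHr qr rr; exists (fun e => A e \/ B e) => [|s].
    exact: semialg_or.
  by rewrite AE BE.
- move=> /andP[qp qr] /andP[rp rr]; have [A AP AE] := IHp qp rp.
  have [B BP BE] := IHr qr rr; exists (fun e => A e -> B e) => [|s].
    exact: semialg_imp.
  by rewrite AE BE.
- move=> qp rp; have [A AP AE] := IHp qp rp.
  by exists (fun e => ~ A e) => [|s]; [exact: semialg_not|rewrite AE].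
Qed.

Definition upd e (i : nat) (v : R) : nat -> R :=
  fun j => if j == i then v else e j.

(** The Tarski-Seidenberg theorem: quantifier elimination yields a formula
    equivalent to the existential one, and a quantifier-free formula denotes a
    semialgebraic predicate.  Formulas are evaluated at finite sequences, which
    is why the environment is truncated beyond the supports of both
    predicates. *)
Lemma semialg_exists_upd i A : semialg A ->
  semialg (fun e => exists v, A (upd e i v)).
Proof.
move=> /semialg_formula[phi [N [rphi phiA]]].
pose ex := ordered_qelim.ord.Exists i phi.
pose psi := ordered_qelim.ord.quantifier_elim
  (fun j bc => qe_rcf.qfr_to_formula (qe_rcf.wproj j bc)) ex.
have /andP[qpsi rpsi] :=
  ordered_qelim.ord.quantifier_elim_wf (@qe_rcf.wf_QE_wproj R) (f := ex) rphi.
have [B BP psiB] := qf_form_semialg qpsi rpsi.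
have [M Bsupp] := semialg_support BP.
apply: semialg_ext BP => e; pose s := mkseq e (maxn N M).
rewrite (Bsupp _ (nth 0 s)) => [|j jM]; last first.
  by rewrite nth_mkseq // leq_max jM orbT.
rewrite -psiB.
have exE : ordered_qelim.ord.holds s psi <-> ordered_qelim.ord.holds s ex.
  rewrite (rwP (ordered_qelim.ord.qf_evalP s qpsi)).
  by rewrite (rwP (ordered_qelim.ord.quantifier_elim_rformP
    (@qe_rcf.wf_QE_wproj R) (@qe_rcf.valid_QE_wproj R) s (f := ex) rphi)).
rewrite exE /=; have E v : ordered_qelim.ord.holds (set_nth 0 s i v) phi
    <-> A (upd e i v).
  apply: phiA => j jN; rewrite nth_set_nth /= /upd; case: eqP => // _.
  by rewrite nth_mkseq // leq_max jN.
by split=> -[v /E ?]; exists v.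
Qed.

(** De Bruijn form of the projection theorem: it applies to a goal of the
    form [semialg (fun e => exists v, ...)] by higher-order unification. *)
Lemma semialg_exists (B : (nat -> R) -> R -> Prop) :
  semialg (fun e => B (fun i => e i.+1) (e 0%N)) ->
  semialg (fun e => exists v, B e v).
Proof.
move=> /(semialg_exists_upd 0) BP.
exact: (semialg_subst (fun i e => e i.-1) _ (fun i => is_poly_var i.-1) BP).
Qed.

Lemma semialg_forall (B : (nat -> R) -> R -> Prop) :
  semialg (fun e => B (fun i => e i.+1) (e 0%N)) ->
  semialg (fun e => forall v, B e v).
Proof.
move=> BP; apply: (@semialg_ext (fun e => ~ exists v, ~ B e v)) => [e|].
  split=> [h v|h [v]]; last exact.
  by apply: contrapT => Bv; apply: h; exists v.
by apply/semialg_not/semialg_exists/semialg_not.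
Qed.

Lemma semialg_exists_block k j A : semialg A ->
  semialg (fun e => exists e',
    (forall i, ~~ (k <= i < k + j)%N -> e' i = e i) /\ A e').
Proof.
move=> AP; elim: j => [|j IHj].
  apply: semialg_ext AP => e; split=> [Ae|[e' [ee' Ae']]]; first by exists e.
  have -> // : e = e'; apply/funext => i; rewrite ee' // addn0.
  by apply/negP => /andP[h /(leq_ltn_trans h)]; rewrite ltnn.
move: IHj => /(semialg_exists_upd (k + j)); apply: semialg_ext => e.
split=> [[v [e' [ee' Ae']]]|[e' [ee' Ae']]].
  exists e'; split=> // i iN; rewrite ee' => [|].
    rewrite /upd; case: eqP => // ik; move: iN.
    by rewrite ik leq_addr addnS ltnSn.
  by apply: contra iN => /andP[-> ik]; rewrite addnS ltnS ltnW.
exists (e' (k + j)%N), e'; split=> // i iN; rewrite /upd.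
case: eqP => [->//|/eqP ik]; apply: ee'.
apply: contra iN => /andP[-> /=]; rewrite addnS ltnS leq_eqVlt.
by rewrite (negbTE ik).
Qed.

Lemma semialg_exists_tail k A : semialg A ->
  semialg (fun e => exists e', (forall i, (i < k)%N -> e' i = e i) /\ A e').
Proof.
move=> AP; have [N AN] := semialg_support AP.
move: (semialg_exists_block k N A AP); apply: semialg_ext => e.
split=> [[e' [ee' Ae']]|[e' [ee' Ae']]].
  by exists e'; split=> // i ik; rewrite ee' // negb_and -ltnNge ik.
exists (fun i => if (k <= i < k + N)%N then e' i else e i); split=> [i /negbTE->//|].
apply: (AN _ e' _).2 Ae' => i iN.
case: ifP => // /negbT; rewrite negb_and -!ltnNge => /orP[/ee'->//|].
by rewrite ltnNge (leq_trans iN (leq_addl k N)).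
Qed.

Lemma semialg_proj2 k l A : semialg A ->
  semialg (fun e => exists e', [/\ e' k = e 0%N, e' l = e 1%N & A e']).
Proof.
move=> AP.
have : semialg (fun e => (e k.+2 = e 0%N /\ e l.+2 = e 1%N)
    /\ A (fun i => e i.+2)).
  apply: semialg_and.
    by apply: semialg_and; apply: semialg_eq; exact: is_poly_var.
  apply: (semialg_subst (fun i e => e i.+2)) AP => i; exact: is_poly_var.
move=> /(semialg_exists_tail 2); apply: semialg_ext => e.
split=> [[e' [ee' [[h0 h1] Ae']]]|[e' [h0 h1 Ae']]].
  by exists (fun i => e' i.+2); rewrite h0 h1 !ee'.
by exists (fun i => if i is j.+2 then e' j else e i); split=> // -[|[]].
Qed.

End Semialgebraic.

(** * One-sided germs and monotonicity of semialgebraic functions *)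

Section Germs.
Context {R : realType}.
Implicit Types (P Q : R -> Prop) (a b s t : R).

Definition right_germ P a := exists d, 0 < d /\ forall v, a < v -> v < a + d -> P v.
Definition left_germ P a := exists d, 0 < d /\ forall v, a - d < v -> v < a -> P v.

Lemma right_germ_and P Q a :
  right_germ P a -> right_germ Q a -> right_germ (fun v => P v /\ Q v) a.
Proof.
move=> [d [d0 Pd]] [d' [d'0 Qd]]; exists (Num.min d d').
rewrite lt_min d0 d'0; split=> // v av; rewrite -ltrBlDl lt_min !ltrBlDl.
by move=> /andP[vd vd']; split; [exact: Pd|exact: Qd].
Qed.

Lemma right_germS P Q a :
  (forall v, P v -> Q v) -> right_germ P a -> right_germ Q a.
Proof. by move=> PQ [d [d0 Pd]]; exists d; split=> // v av vd; exact/PQ/Pd. Qed.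

Lemma right_germ_gt a : right_germ (fun v => a < v) a.
Proof. by exists 1. Qed.

Lemma left_germ_ex P a b : b < a -> left_germ P a -> exists v, [/\ b < v, v < a & P v].
Proof.
move=> ba [d [d0 Pd]]; have : Num.max b (a - d) < a.
  by rewrite gt_max ba ltrBlDr ltrDl d0.
move=> /midf_lt[]; set v := _ / _ => bv va; exists v.
by move: bv; rewrite gt_max => /andP[-> adv]; split=> //; exact: Pd.
Qed.

Lemma left_germ_opp P a : left_germ P a <-> right_germ (fun v => P (- v)) (- a).
Proof.
split=> -[d [d0 Pd]]; exists d; split=> // v.
  by move=> va dv; apply: Pd; lra.
by move=> av va; rewrite -[v]opprK; apply: Pd; lra.
Qed.

(** After division by the maximal power of ['X - a], which is positive on the
    right of [a], the polynomial does not vanish at [a] and continuity applies. *)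
Lemma horner_sign_right_germ (r : {poly R}) a :
  right_germ (fun v => 0 < r.[v]) a \/ right_germ (fun v => ~ 0 < r.[v]) a.
Proof.
have [->|r0] := eqVneq r 0.
  by right; exists 1; split=> // v _ _; rewrite horner0 ltxx.
have [m [q /implyP/(_ r0) qa rE]] := multiplicity_XsubC r a.
have rS v : a < v -> (0 < r.[v]) = (0 < q.[v]).
  move=> av; rewrite rE hornerM horner_exp hornerXsubC pmulr_lgt0 //.
  by rewrite exprn_gt0 // subr_gt0.
have /cvgrPdist_lt/(_ `|q.[a]|) := @continuous_horner R q a.
rewrite normr_gt0 => /(_ qa) /nbhs_ballP[d /= d0 qd].
have near_q v : a < v -> v < a + d -> `|q.[a] - q.[v]| < `|q.[a]|.
  move=> av vd; apply: qd; rewrite /ball /= distrC ger0_norm ?subr_ge0 1?ltW//.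
  by rewrite ltrBlDl.
have [qa0|qa0|qa0] := ltgtP q.[a] 0; last by move: qa; rewrite /root qa0 eqxx.
  right; exists d; split=> // v av vd; rewrite rS //.
  have := near_q v av vd; rewrite (ltr0_norm qa0) ltr_norml => /andP[+ _].
  by rewrite opprK => h; apply/negP; rewrite -leNgt; lra.
left; exists d; split=> // v av vd; rewrite rS //.
have := near_q v av vd; rewrite (gtr0_norm qa0) ltr_norml => /andP[_].
lra.
Qed.

Lemma is_poly_upd {f} : is_poly f -> forall e i,
  exists r : {poly R}, forall v, f (upd e i v) = r.[v].
Proof.
move=> fP e i; elim: fP => [j|c|g h _ [r rE] _ [q qE]|g h _ [r rE] _ [q qE]].
- exists (if j == i then 'X else (e j)%:P) => v; rewrite /upd.
  by case: eqP; rewrite (hornerX, hornerC).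
- by exists c%:P => v; rewrite hornerC.
- by exists (r + q) => v; rewrite hornerD rE qE.
- by exists (r * q) => v; rewrite hornerM rE qE.
Qed.

(** The form of o-minimality on which everything below relies. *)
Lemma semialg_right_dichotomy {A} : semialg A -> forall e i a,
  right_germ (fun v => A (upd e i v)) a \/ right_germ (fun v => ~ A (upd e i v)) a.
Proof.
move=> AP e i a; elim: AP => [f fP|B _ [IH|IH]|B C _ IHB _ IHC].
- have [r fE] := is_poly_upd fP e i.
  by have [h|h] := horner_sign_right_germ r a; [left|right];
    apply: right_germS h => v; rewrite fE.
- by right; apply: right_germS IH => v Bv nBv; exact: nBv.
- by left.
- case: IHB => [hB|hB].
    case: IHC => [hC|hC]; first by left; exact: right_germ_and.
    by right; apply: right_germS hC => v + [].
  by right; apply: right_germS hB => v + [].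
Qed.

Lemma right_dichotomy (S : R -> Prop) : semialg (fun e => S (e 0%N)) ->
  forall a, right_germ S a \/ right_germ (fun v => ~ S v) a.
Proof. by move=> SP a; exact: (semialg_right_dichotomy SP (fun=> 0) 0%N a). Qed.

Lemma left_dichotomy (S : R -> Prop) : semialg (fun e => S (e 0%N)) ->
  forall a, left_germ S a \/ left_germ (fun v => ~ S v) a.
Proof.
move=> SP a.
have SNP : semialg (fun e : nat -> R => S (- e 0%N)).
  by apply: (semialg_subst (fun i e => - e i) _ _ SP) => i;
    exact/is_polyN/is_poly_var.
have := right_dichotomy (fun v => S (- v)) SNP (- a).
by rewrite !left_germ_opp.
Qed.

Lemma semialg_right_germ (Q : (nat -> R) -> R -> Prop) f : is_poly f ->
  semialg (fun e => Q (fun i => e i.+1) (e 0%N)) ->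
  semialg (fun e => right_germ (Q e) (f e)).
Proof.
move=> fP QP; apply: semialg_exists; apply: semialg_and.
  by apply: semialg_lt; [exact: is_poly_cst|exact: is_poly_var].
have fS k : is_poly (fun e => f (fun i => e (k + i)%N)).
  by apply: (is_poly_subst (fun i e => e (k + i)%N)) fP => i; exact: is_poly_var.
apply: semialg_forall; apply: semialg_imp.
  by apply: semialg_lt; [exact: (fS 2%N)|exact: is_poly_var].
apply: semialg_imp.
  by apply: semialg_lt; [|apply: is_polyD; [exact: (fS 2%N)|]]; exact: is_poly_var.
apply: (semialg_subst (fun i e => if i is j.+1 then e j.+2 else e 0%N) _ _ QP).
by case=> [|i]; exact: is_poly_var.
Qed.

Lemma semialg_left_germ (Q : (nat -> R) -> R -> Prop) f : is_poly f ->
  semialg (fun e => Q (fun i => e i.+1) (e 0%N)) ->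
  semialg (fun e => left_germ (Q e) (f e)).
Proof.
move=> fP QP; apply: (@semialg_ext _ (fun e => right_germ (fun v => Q e (- v)) (- f e))).
  by move=> e; rewrite left_germ_opp.
apply: semialg_right_germ; first exact: is_polyN.
apply: (semialg_subst (fun i e => if i is 0 then - e 0%N else e i) _ _ QP).
by case=> [|i]; rewrite /=; [apply: is_polyN|]; exact: is_poly_var.
Qed.

Lemma semialg_subst2 {C : R -> R -> Prop} {f g} :
  semialg (fun e => C (e 0%N) (e 1%N)) -> is_poly f -> is_poly g ->
  semialg (fun e => C (f e) (g e)).
Proof.
move=> CP fP gP; apply: (semialg_subst (fun i => if i is 0 then f else g) _ _ CP).
by case.
Qed.

(** The infimum of a set of counterexamples would satisfy [P] by the first
    hypothesis, and then could not be their infimum by the second. *)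
Lemma real_induction {a b P} :
  (forall t, a <= t <= b -> (forall u, a <= u < t -> P u) -> P t) ->
  (forall t, a <= t < b -> (forall u, a <= u <= t -> P u) -> right_germ P t) ->
  forall t, a <= t <= b -> P t.
Proof.
move=> closedP openP t0 /andP[at0 t0b]; apply: contrapT => nPt0.
pose B := [set t | a <= t <= b /\ ~ P t].
have Bt0 : B t0 by split=> //; rewrite at0.
have lbB : has_lbound B by exists a => t [/andP[]].
have am : a <= inf B by apply: lb_le_inf; [exists t0|move=> t [/andP[]]].
have mt0 : inf B <= t0 by exact: (ge_inf lbB).
have Plt u : a <= u < inf B -> P u.
  move=> /andP[au um]; apply: contrapT => nPu.
  suff : inf B <= u by rewrite leNgt um.
  apply: (ge_inf lbB); split=> //; rewrite au /=.
  by rewrite (le_trans (ltW um)) // (le_trans mt0).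
have Pm : P (inf B) by apply: closedP => //; rewrite am (le_trans mt0).
have mlt : inf B < t0.
  by rewrite lt_neqAle mt0 andbT; apply/eqP => mE; apply: nPt0; rewrite -mE.
have [||d [d0 Pd]] := openP (inf B).
- by rewrite am (lt_le_trans mlt).
- move=> u /andP[au]; rewrite le_eqVlt => /orP[/eqP->//|um].
  by apply: Plt; rewrite au.
suff : inf B + d <= inf B by lra.
apply: lb_le_inf; first by exists t0.
move=> t [/andP[a_t tb] nPt]; rewrite leNgt; apply/negP => td; apply: (nPt).
have : inf B <= t by apply: (ge_inf lbB); split=> //; rewrite a_t.
by rewrite le_eqVlt => /orP[/eqP<-//|mt]; exact: Pd.
Qed.

Lemma locally_nondecreasing (F : R -> R) a b :
  (forall t, a <= t < b -> right_germ (fun u => F t <= F u) t) ->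
  (forall t, a < t <= b -> left_germ (fun u => F u <= F t) t) ->
  a <= b -> F a <= F b.
Proof.
move=> incR incL ab.
apply: (@real_induction a b (fun u => F a <= F u)); last by rewrite ab lexx.
- move=> u /andP[+ ub] IH; rewrite le_eqVlt => /orP[/eqP->//|au].
  have [|v [av vu Fv]] := left_germ_ex _ _ _ au (incL u _); first by rewrite au.
  by apply: le_trans Fv; apply: IH; rewrite (ltW av).
- move=> u /andP[au ub] IH; have uab : a <= u < b by rewrite au.
  apply: right_germS (incR u uab) => v; apply: le_trans.
  by apply: IH; rewrite au lexx.
Qed.

(** A relation that holds between every point of an interval and all its
    near neighbours cannot be antisymmetric: points with the same scale
    [1 / (n + 1)] of validity would be [1 / (n + 1)]-separated, making the
    interval countable. *)
Lemma no_everywhere_extremum (T : R -> R -> Prop) a b : a < b ->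
  (forall s t, a < s -> s < t -> t < b -> T s t -> T t s -> False) ->
  ~ (forall s, a < s < b -> right_germ (T s) s /\ left_germ (T s) s).
Proof.
move=> ab antiT loc.
have /choice[d dP] : forall s, exists d, a < s < b ->
    0 < d /\ forall t, t != s -> `|t - s| < d -> T s t.
  move=> s; have [/loc[[d [d0 Td]] [d' [d'0 Td']]]|] := boolP (a < s < b); last by exists 0.
  exists (Num.min d d') => _; rewrite lt_min d0 d'0; split=> // t.
  rewrite lt_min neq_lt => /orP[ts|st].
    rewrite ltr0_norm ?subr_lt0 // opprB => /andP[_ td]; apply: Td' => //; lra.
  rewrite gtr0_norm ?subr_gt0 // => /andP[td _]; apply: Td => //; lra.
pose n s := Num.truncn (d s)^-1.
have nP s : a < s < b -> (n s).+1%:R^-1 < d s.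
  move=> /dP[ds _]; rewrite invf_plt ?posrE ?ltr0Sn //; exact: truncnS_gt.
suff : countable [set` `]a, b[].
  move=> /countable_lebesgue_measure0; rewrite lebesgue_measure_itv /= lte_fin ab.
  by move=> /eqP; rewrite -EFinD eqe subr_eq0 gt_eqF.
apply/countable_injP.
exists (fun s => pickle (n s, Num.floor (s * (n s).+1%:R))).
have half s t : a < s -> s < t -> t < b -> n s = n t ->
    Num.floor (s * (n s).+1%:R) = Num.floor (t * (n t).+1%:R) -> False.
  move=> sa st tb nE fE; have sab : a < s < b by rewrite sa (lt_trans st).
  have tab : a < t < b by rewrite tb (lt_trans sa).
  have close : t - s < (n s).+1%:R^-1.
    have /andP[h1 _] := floor_itv (s * (n s).+1%:R).
    have /andP[_ h2] := floor_itv (t * (n t).+1%:R).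
    rewrite -fE -nE intrD in h2; rewrite -[ltRHS]mul1r ltr_pdivlMr ?ltr0Sn //.
    rewrite mulrBl; lra.
  apply: (antiT s t) => //.
    apply: (dP s sab).2; first by rewrite gt_eqF.
    by rewrite gtr0_norm ?subr_gt0 // (lt_trans close) // nP.
  apply: (dP t tab).2; first by rewrite lt_eqF.
  by rewrite distrC gtr0_norm ?subr_gt0 // (lt_trans close) // nE nP.
move=> s t; rewrite !inE /= !in_itv /= => /andP[sa sb] /andP[ta tb].
move=> /(pcan_inj pickleK)[nE fE]; have [st|ts|//] := ltgtP s t.
  by have := half s t sa st tb nE fE.
by have := half t s ta ts sb (esym nE) (esym fE).
Qed.

Lemma semialg_app {c : R -> R} (Q : (nat -> R) -> R -> Prop) f :
  semialg (fun e => e 1%N = c (e 0%N)) -> is_poly f ->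
  semialg (fun e => Q (fun i => e i.+1) (e 0%N)) ->
  semialg (fun e => Q e (c (f e))).
Proof.
move=> cP fP QP; apply: (@semialg_ext _ (fun e => exists y, y = c (f e) /\ Q e y)).
  by move=> e; split=> [[y [->]]|h] //; exists (c (f e)).
apply: semialg_exists; apply: semialg_and => //.
apply: (@semialg_subst2 (fun s y => y = c s)) => //; last exact: is_poly_var.
by apply: (is_poly_subst (fun i e => e i.+1)) fP => i; exact: is_poly_var.
Qed.

(** Near [0+] the type of the right and left germ of [c] at [s] (growing or
    not) does not depend on [s].  If the two types agree [c] is monotone; if
    they do not, every [s] is a one-sided strict extremum of [c]. *)
Lemma semialg_fun_monotone (c : R -> R) : semialg (fun e => e 1%N = c (e 0%N)) ->
  exists r, 0 < r /\
    ((forall s t, 0 < s -> s <= t -> t < r -> c s <= c t) \/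
     (forall s t, 0 < s -> s <= t -> t < r -> c t <= c s)).
Proof.
move=> cP.
have leP f g : is_poly f -> is_poly g -> semialg (fun e => c (f e) <= c (g e)).
  move=> fP gP; apply: (semialg_app (fun e y => y <= c (g e)) _ cP fP).
  apply: (semialg_app (fun e y => e 0%N <= y) (fun e => g (fun i => e i.+1)) cP).
    by apply: (is_poly_subst (fun i e => e i.+1)) gP => i; exact: is_poly_var.
  by apply: semialg_le; exact: is_poly_var.
pose U s := right_germ (fun t => c s <= c t) s.
pose L s := left_germ (fun t => c t <= c s) s.
have UP : semialg (fun e => U (e 0%N)).
  apply: (semialg_right_germ (fun e t => c (e 0%N) <= c t)); first exact: is_poly_var.
  by apply: leP; exact: is_poly_var.
have LP : semialg (fun e => L (e 0%N)).
  apply: (semialg_left_germ (fun e t => c t <= c (e 0%N))); first exact: is_poly_var.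
  by apply: leP; exact: is_poly_var.
have notU s : ~ U s -> right_germ (fun t => c t < c s) s.
  have : semialg (fun e => c s <= c (e 0%N)).
    by apply: (leP (fun=> s)); [exact: is_poly_cst|exact: is_poly_var].
  move=> /(right_dichotomy (fun t => c s <= c t))/(_ s)[//|+ _]; apply: right_germS => v /negP.
  by rewrite -ltNge.
have notL s : ~ L s -> left_germ (fun t => c s < c t) s.
  have : semialg (fun e => c (e 0%N) <= c s).
    by apply: (leP _ (fun=> s)); [exact: is_poly_var|exact: is_poly_cst].
  move=> /(left_dichotomy (fun t => c t <= c s))/(_ s)[//|[d [d0 h]] _].
  exists d; split=> // v sv vs.
  by rewrite ltNge; apply/negP/h.
have weakR s : right_germ (fun t => c t < c s) s -> right_germ (fun t => c t <= c s) s.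
  by apply: right_germS => v /ltW.
have weakL s : left_germ (fun t => c s < c t) s -> left_germ (fun t => c s <= c t) s.
  by move=> [d [d0 h]]; exists d; split=> // v sv vs; exact/ltW/h.
case: (right_dichotomy U UP 0) => hU; case: (right_dichotomy L LP 0) => hL;
  have [r [r0 hr]] := right_germ_and _ _ _ hU hL; rewrite add0r in hr; exists r; split=> //.
- left=> s t s0 st tr; apply: locally_nondecreasing st => u /andP[su ut].
    by have [] := hr u (lt_le_trans s0 su) (lt_trans ut tr).
  by have [] := hr u (lt_trans s0 su) (le_lt_trans ut tr).
- exfalso; apply: (@no_everywhere_extremum
    (fun s t => (s < t -> c s <= c t) /\ (t < s -> c s < c t)) 0 r r0).
    move=> s t s0 st tr [/(_ st) h _] [_ /(_ st)]; by rewrite ltNge h.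
  move=> s /andP[s0 sr]; have [Us /notL Ls] := hr s s0 sr; split.
    have := right_germ_and _ _ _ Us (right_germ_gt s); apply: right_germS.
    by move=> v [? sv]; split=> // vs; have := lt_trans sv vs; rewrite ltxx.
  have [d [d0 h]] := Ls; exists d; split=> // v dv vs; split=> [sv|_]; last exact: h.
  by have := lt_trans sv vs; rewrite ltxx.
- exfalso; apply: (@no_everywhere_extremum
    (fun s t => (s < t -> c t < c s) /\ (t < s -> c t <= c s)) 0 r r0).
    move=> s t s0 st tr [/(_ st) h _] [_ /(_ st)]; by rewrite leNgt h.
  move=> s /andP[s0 sr]; have [/notU Us Ls] := hr s s0 sr; split.
    have := right_germ_and _ _ _ Us (right_germ_gt s); apply: right_germS.
    by move=> v [? sv]; split=> // vs; have := lt_trans sv vs; rewrite ltxx.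
  have [d [d0 h]] := Ls; exists d; split=> // v dv vs; split=> [sv|_]; last exact: h.
  by have := lt_trans sv vs; rewrite ltxx.
- right=> s t s0 st tr; rewrite -lerN2.
  apply: (@locally_nondecreasing (fun u => - c u)) st => u /andP[su ut].
    have [/notU/weakR Uu _] := hr u (lt_le_trans s0 su) (lt_trans ut tr).
    by apply: right_germS Uu => v; rewrite lerN2.
  have [_ /notL/weakL [d [d0 h]]] := hr u (lt_trans s0 su) (le_lt_trans ut tr).
  by exists d; split=> // v dv vu; rewrite lerN2; exact: h.
Qed.

End Germs.

(** * Semialgebraic selection *)

(** Before each use the goal must be in beta-normal form, as the indices of
    the bound variables are read off the goal by unification. *)
Ltac semialg_step := first
  [ apply: semialg_exists | apply: semialg_and | apply: semialg_or
  | apply: semialg_imp | apply: semialg_not | apply: semialg_le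
  | apply: semialg_lt | apply: semialg_eq | apply: semialg_forall
  | apply: is_poly_var | apply: is_poly_cst | apply: is_polyD
  | apply: is_polyM | apply: is_polyX | apply: is_polyN ]; cbv beta.

Section Choice.
Context {R : realType}.

(** With [a] the infimum of the fibre [P s] and [b] the largest number up to
    [a + 1] such that [P s] holds between [a] and [b], the midpoint of [a] and
    [b] belongs to [P s] and depends on [s] in a first-order way: either
    [a < b], or [a] is an isolated point of the fibre.  The bound [a + 1] only
    serves to make [b] finite. *)
Lemma semialg_choice (P : R -> R -> Prop) :
  semialg (fun e => P (e 0%N) (e 1%N)) ->
  exists c : R -> R, semialg (fun e => e 1%N = c (e 0%N)) /\
    forall s, (exists y, P s y) -> (exists m, forall y, P s y -> m <= y) ->
      P s (c s).
Proof.
move=> PP.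
pose is_inf s a := (forall y, P s y -> a <= y) /\
  forall a', (forall y, P s y -> a' <= y) -> a' <= a.
pose below s a b := b <= a + 1 /\ forall z, a < z -> z < b -> P s z.
pose C s y := exists a b,
  [/\ is_inf s a, below s a b, (forall b', below s a b' -> b' <= b) & y + y = a + b].
have C_fun s y y' : C s y -> C s y' -> y = y'.
  move=> [a [b [[aP amax] bI bmax yE]]] [a' [b' [[aP' amax'] bI' bmax' yE']]].
  have aE : a = a' by apply/eqP; rewrite eq_le amax' // amax.
  rewrite -aE in bI' bmax' yE'.
  have bE : b = b' by apply/eqP; rewrite eq_le bmax' // bmax.
  by rewrite -bE in yE'; lra.
have CP s y : C s y -> P s y.
  move=> [a [b [[aP amax] bI bmax yE]]].
  have : a <= b by apply: bmax; split=> [|z az za]; lra.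
  rewrite le_eqVlt => /orP[/eqP ab|ab]; last by apply: bI.2; lra.
  have -> : y = a by lra.
  have PsP : semialg (fun e => P s (e 0%N)).
    by apply: (semialg_subst2 PP); repeat semialg_step.
  apply: contrapT => nPa; have [[d [d0 Pd]]|[d [d0 nPd]]] := right_dichotomy _ PsP a.
    have : a + Num.min d 1 <= b.
      apply: bmax; split=> [|z az]; first by rewrite lerD2l ge_min lexx orbT.
      rewrite -ltrBlDl lt_min => /andP[zd _]; apply: Pd => //; lra.
    by rewrite -ab gerDl leNgt lt_min d0 ltr01.
  suff : a + d <= a by lra.
  apply: amax => y' Py'; rewrite leNgt; apply/negP => y'd.
  have := aP y' Py'; rewrite le_eqVlt => /orP[/eqP ay'|ay'].
    by apply: nPa; rewrite ay'.
  exact: nPd ay' y'd Py'.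
have Csemialg f g : is_poly f -> is_poly g -> semialg (fun e => C (f e) (g e)).
  move=> fP gP; apply: (@semialg_subst2 _ C) => //.
  apply: (@semialg_ext _ (fun e => exists a b, (is_inf (e 0%N) a /\ below (e 0%N) a b) /\
    ((forall b', below (e 0%N) a b' -> b' <= b) /\ e 1%N + e 1%N = a + b))).
    move=> e; split=> [[a [b [[? ?] [? ?]]]]|[a [b [? ? ? ?]]]]; by exists a, b.
  rewrite /is_inf /below.
  by repeat (semialg_step || apply: (semialg_subst2 PP)).
exists (fun s => xget 0 (C s)); split; last first.
  move=> s [y0 Py0] [m mP]; apply: CP; apply: xgetPex.
  pose a := inf [set y | P s y]; pose b := sup [set b | below s a b].
  have lbP : has_lbound [set y | P s y] by exists m.
  have supB : has_sup [set b | below s a b].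
    split; last by exists (a + 1) => z [].
    by exists a; split=> [|z az za]; lra.
  exists ((a + b) / 2); exists a, b; split.
  - split=> [y Py|a' a'P]; first exact: (ge_inf lbP).
    by apply: lb_le_inf => //; exists y0.
  - split=> [|z az zb].
      by apply: ge_sup => [|z []//]; case: supB.
    have bz : 0 < b - z by rewrite subr_gt0.
    have [b' [_ b'P]] := sup_adherent bz supB.
    by rewrite opprB addrC subrK => ?; exact: b'P.
  - by move=> b' b'P; apply: sup_ubound => //; case: supB.
  - lra.
apply: (@semialg_ext _ (fun e => C (e 0%N) (e 1%N) \/
  ((~ exists y, C (e 0%N) y) /\ e 1%N = 0))) => [e|].
  case: xgetP => [y _ Cy|nC]; split.
  - by move=> [/C_fun/(_ Cy)//|[[]]]; exists y.
  - by move=> ->; left.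
  - by move=> [/nC//|[]].
  - by move=> ->; right; split=> // -[y /nC].
apply: semialg_or; first by apply: Csemialg; exact: is_poly_var.
apply: semialg_and; last by repeat semialg_step.
by apply/semialg_not/semialg_exists/Csemialg; exact: is_poly_var.
Qed.

(** The coordinates are selected one after the other, each choice restricting
    the set from which the next one is made. *)
Lemma semialg_curve_selection m (A : (nat -> R) -> Prop) (lo : nat -> R) :
  semialg A -> (forall e i, A e -> (i < m)%N -> lo i <= e i.+1) ->
  exists c : nat -> R -> R,
    (forall i, (i < m)%N -> semialg (fun e => e 1%N = c i (e 0%N))) /\
    forall s, (exists e, e 0%N = s /\ A e) ->
      exists e, [/\ e 0%N = s, A e & forall i, (i < m)%N -> e i.+1 = c i s].
Proof.
move=> AP loP; suff [c [cP [A' [A'P A'A sA']]]] : exists c : nat -> R -> R,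
    (forall i, (i < m)%N -> semialg (fun e => e 1%N = c i (e 0%N))) /\
    exists A', [/\ semialg A',
      (forall e, A' e -> A e /\ forall i, (i < m)%N -> e i.+1 = c i (e 0%N)) &
      forall s, (exists e, e 0%N = s /\ A e) -> (exists e, e 0%N = s /\ A' e)].
  exists c; split=> // s /sA'[e [es /A'A[Ae ce]]]; exists e; split=> //.
  by rewrite -es.
elim: m loP => [|m IHm] loP; first by exists (fun=> id); split=> //; exists A.
have [e i Ae im|c [cP [A' [A'P A'A sA']]]] := IHm.
  by apply: loP => //; exact: ltnW.
pose P s y := exists e, [/\ e 0%N = s, e m.+1 = y & A' e].
have PP : semialg (fun e => P (e 0%N) (e 1%N)) by exact: semialg_proj2.
have [cm [cmP cmE]] := semialg_choice _ PP.
exists (fun i => if i == m then cm else c i); split.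
  move=> i; rewrite ltnS leq_eqVlt => /orP[/eqP->|im]; first by rewrite eqxx.
  by rewrite ltn_eqF //; exact: cP.
exists (fun e => A' e /\ e m.+1 = cm (e 0%N)); split.
- apply: semialg_and => //.
  by apply: (@semialg_subst2 _ (fun s y => y = cm s)) => //; exact: is_poly_var.
- move=> e [A'e em]; have [Ae ce] := A'A e A'e; split=> // i.
  rewrite ltnS leq_eqVlt; case: eqP => [->//|_ /= im]; exact: ce.
- move=> s /sA'[e [es A'e]]; have [||e' [e's e'm A'e']] := cmE s.
  + by exists (e m.+1), e.
  + by exists (lo m) => y [e' [_ <- /A'A[Ae' _]]]; exact: loP.
  + by exists e'; rewrite e's.
Qed.

End Choice.

(** * Gradients of rational functions *)

Section PolynomialMaps.
Context {R : realType} {n : nat}.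
Implicit Types (f g : 'rV[R]_n -> R) (x y : 'rV[R]_n) (p q : mpoly.mpoly n R).

(** The point stored in an environment: coordinates 0 and 1 are left for the
    level of the function and for the squared norm of its gradient. *)
Definition env_point (e : nat -> R) : 'rV[R]_n := \row_(i < n) e i.+2.

Definition poly_map f := is_poly (fun e => f (env_point e)).

(** Polynomial maps are closed under partial derivatives; carrying the
    derivatives along makes this provable by induction on their construction. *)
Definition diff_poly_map f := poly_map f /\ exists df : 'I_n -> 'rV[R]_n -> R,
  (forall i, poly_map (df i)) /\
  (forall x, differentiable f x /\ forall i, 'D_(delta_mx 0 i) f x = df i x).

Lemma diff_poly_map_cst c : diff_poly_map (fun=> c).
Proof.
split; first exact: is_poly_cst.
exists (fun _ _ => 0); split=> [i|x]; first exact: is_poly_cst.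
by split=> [|i]; [exact: differentiable_cst|exact: derive_cst].
Qed.

Lemma diff_poly_map_coord i : diff_poly_map (fun x => x 0 i).
Proof.
split; first by apply: is_poly_ext (is_poly_var i.+2) => e; rewrite mxE.
exists (fun j _ => (delta_mx 0 j : 'rV[R]_n) 0 i); split=> [j|x].
  exact: is_poly_cst.
have dx := @differentiable_coord R 1 n x 0 i.
split=> // j; rewrite deriveE //.
have @l : {linear 'rV[R]_n -> R}.
  by exists (fun N : 'M[R]_(1, n) => N 0 i); do 2![eexists]; do ?[constructor];
     rewrite ?mxE// => ? *; rewrite ?mxE//; move=> ?; rewrite !mxE.
rewrite (_ : (fun _ => _) = l) // (diff_lin x) //.
exact: coord_continuous.
Qed.

Lemma diff_poly_mapD f g : diff_poly_map f -> diff_poly_map g ->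
  diff_poly_map (fun x => f x + g x).
Proof.
move=> [fP [df [dfP fE]]] [gP [dg [dgP gE]]]; split; first exact: is_polyD.
exists (fun i x => df i x + dg i x); split=> [i|x].
  exact: (is_polyD _ _ (dfP i) (dgP i)).
have [fx fxE] := fE x; have [gx gxE] := gE x; split=> [|i].
  exact: differentiableD.
by rewrite (@deriveD _ _ _ f g) ?fxE ?gxE //; exact: diff_derivable.
Qed.

Lemma diff_poly_mapM f g : diff_poly_map f -> diff_poly_map g ->
  diff_poly_map (fun x => f x * g x).
Proof.
move=> [fP [df [dfP fE]]] [gP [dg [dgP gE]]]; split; first exact: is_polyM.
exists (fun i x => f x * dg i x + g x * df i x); split=> [i|x].
  exact: (is_polyD _ _ (is_polyM _ _ fP (dgP i)) (is_polyM _ _ gP (dfP i))).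
have [fx fxE] := fE x; have [gx gxE] := gE x; split=> [|i].
  exact: differentiableM.
by rewrite (@deriveM _ _ f g) ?fxE ?gxE //; exact: diff_derivable.
Qed.

Lemma diff_poly_map_big (op : R -> R -> R) (idx : R) (I : Type) (r : seq I)
    (F : I -> 'rV[R]_n -> R) :
  (forall f g, diff_poly_map f -> diff_poly_map g ->
    diff_poly_map (fun x => op (f x) (g x))) ->
  (forall i, diff_poly_map (F i)) ->
  diff_poly_map (fun x => \big[op/idx]_(i <- r) F i x).
Proof.
move=> opP FP; elim: r => [|i r IHr].
  rewrite (_ : (fun=> _) = fun=> idx); first exact: diff_poly_map_cst.
  by apply/funext => x; rewrite big_nil.
rewrite (_ : (fun=> _) = fun x => op (F i x) (\big[op/idx]_(j <- r) F j x)).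
  exact: opP.
by apply/funext => x; rewrite big_cons.
Qed.

Lemma diff_poly_map_polyfun p : diff_poly_map (polyfun p).
Proof.
rewrite (_ : polyfun p = fun x => \sum_(m <- mpoly.msupp p)
    mpoly.mcoeff m p * \prod_(i < n) x 0 i ^+ mpoly.fun_of_multinom m i); last first.
  by apply/funext => x; rewrite /polyfun mpoly.mevalE.
apply: diff_poly_map_big; first exact: diff_poly_mapD.
move=> m; apply: diff_poly_mapM; first exact: diff_poly_map_cst.
apply: diff_poly_map_big => [|i]; first exact: diff_poly_mapM.
elim: (mpoly.fun_of_multinom m i) => [|k IHk]; first exact: diff_poly_map_cst.
rewrite (_ : (fun=> _) = fun x : 'rV[R]_n => x 0 i * x 0 i ^+ k).
  exact: diff_poly_mapM (diff_poly_map_coord i) IHk.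
by apply/funext => x; rewrite exprS.
Qed.

Lemma enorm_ge0 x : 0 <= enorm x. Proof. exact: sqrtr_ge0. Qed.

Lemma sqr_enorm x : enorm x ^+ 2 = \sum_(i < n) x 0 i ^+ 2.
Proof. by rewrite sqr_sqrtr // sumr_ge0 // => i _; exact: sqr_ge0. Qed.

Lemma coord_le_enorm x i : `|x 0 i| <= enorm x.
Proof.
rewrite -sqrtr_sqr ler_sqrt ?sqr_ge0 //; last first.
  by apply: sumr_ge0 => j _; exact: sqr_ge0.
by rewrite (bigD1 i) //= lerDl sumr_ge0 // => j _; exact: sqr_ge0.
Qed.

(** Multiplying by [q ^+ 4] clears the denominators of the squared gradient. *)
Lemma ratfun_gradient p q : exists2 G : 'rV[R]_n -> R, poly_map G &
  forall x, ratdom q x -> differentiable (ratfun p q) x /\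
    enorm (gradient (ratfun p q) x) ^+ 2 * polyfun q x ^+ 4 = G x.
Proof.
have [pP [dp [dpP pE]]] := diff_poly_map_polyfun p.
have [qP [dq [dqP qE]]] := diff_poly_map_polyfun q.
exists (fun x => \sum_(i < n) (dp i x * polyfun q x - polyfun p x * dq i x) ^+ 2).
  apply: is_poly_sum => i; apply/is_polyX/is_polyB.
    exact: (is_polyM _ _ (dpP i) qP).
  exact: (is_polyM _ _ pP (dqP i)).
move=> x; rewrite /ratdom /= => qx.
have [px pxE] := pE x; have [qdx qxE] := qE x.
have dV : differentiable (fun y => (polyfun q y)^-1) x by exact: differentiableV.
split; first exact: (differentiableM px dV).
rewrite sqr_enorm mulr_suml; apply: eq_bigr => i _.
rewrite mxE (@deriveM _ _ (polyfun p) (fun y => (polyfun q y)^-1));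
  [|exact: diff_derivable..].
rewrite deriveV //; last exact: diff_derivable.
rewrite pxE qxE /GRing.scale /=; field.
exact: qx.
Qed.

Definition norm1 x : R := \sum_(i < n) `|x 0 i|.

Lemma norm_le_norm1 x : `|x| <= norm1 x.
Proof.
rewrite [`|x|]mx_normrE; apply/bigmax_leP; split=> [|[i j] _ /=].
  by apply: sumr_ge0 => i _.
rewrite (ord1 i) /norm1 (bigD1 j) //= lerDl; exact: sumr_ge0.
Qed.

(** The l1-norm dominates the ambient norm, in which the remainder is small,
    and it is additive along coordinatewise monotone paths. *)
Lemma differentiable_norm1_bound f x K :
  differentiable f x -> enorm (gradient f x) < K ->
  exists eta, 0 < eta /\
    forall y, norm1 (y - x) < eta -> `|f y - f x| <= K * norm1 (y - x).
Proof.
move=> fx gK; have K0 : 0 < K - enorm (gradient f x) by rewrite subr_gt0.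
have /eqaddoP/(_ _ K0) := diff_locally fx.
move=> /nbhs_ballP[d /= d0 dP]; exists d; split=> // y yd.
have /dP /= : ball 0 d (y - x).
  by rewrite mx_norm_ball /ball_ /= sub0r normrN (le_lt_trans (norm_le_norm1 _)).
rewrite !fctE /= subrK opprD addrA => h.
have lin : `|'d f x (y - x)| <= enorm (gradient f x) * norm1 (y - x).
  rewrite {1}(row_sum_delta (y - x)) linear_sum /= (le_trans (ler_norm_sum _ _ _)) //.
  rewrite mulr_sumr; apply: ler_sum => i _.
  rewrite linearZ /= normrM mulrC ler_wpM2r // -deriveE //.
  by have := coord_le_enorm (gradient f x) i; rewrite mxE.
rewrite -[f y - f x](subrK ('d f x (y - x))) (le_trans (ler_normD _ _)) //.
rewrite -[leRHS](subrK (enorm (gradient f x) * norm1 (y - x))) lerD //.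
rewrite -mulrBl; apply: (le_trans h); apply: ler_wpM2l; first exact: ltW.
exact: norm_le_norm1.
Qed.

End PolynomialMaps.

(** * The Kurdyka-Lojasiewicz inequality *)

Section KurdykaLojasiewicz.
Context {R : realType} {n : nat}.
Context (p q : mpoly.mpoly n R) (xs : 'rV[R]_n) (l : R).
Let f := ratfun p q.
Let g x := enorm (gradient f x).

Definition at_level s x := [/\ ratdom q x, enorm (x - xs) <= 1 & f x = l + s].

(** The infimum of the slopes on a level need not be attained, since the part of
    the domain in the ball is not compact; the factor 4 and the term [s ^+ 2]
    leave room for an almost minimal choice, even if the infimum is 0. *)
Lemma steepest_curve : exists (c : R -> R) (y : nat -> R -> R),
  [/\ semialg (fun e => exists x, at_level (e 0%N) x),
    semialg (fun e => e 1%N = c (e 0%N)),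
    forall i, (i < n)%N -> semialg (fun e => e 1%N = y i (e 0%N)) &
    forall s, 0 < s -> (exists x, at_level s x) ->
      [/\ at_level s (\row_(i < n) y i s), c s = g (\row_(i < n) y i s) ^+ 2 &
          forall x, at_level s x -> c s <= 4 * g x ^+ 2 + s ^+ 2]].
Proof.
have [G GP GE] := ratfun_gradient p q.
have [pP _] := diff_poly_map_polyfun p.
have [qP _] := diff_poly_map_polyfun q.
pose E e := let x : 'rV[R]_n := env_point e in
  ((polyfun q x <> 0 /\ \sum_(i < n) (e i.+2 - xs 0 i) ^+ 2 <= 1) /\
  (polyfun p x = (l + e 0%N) * polyfun q x /\ e 1%N * polyfun q x ^+ 4 = G x)).
have EP : semialg E.
  apply: semialg_and; apply: semialg_and.
  - by apply: semialg_not; apply: semialg_eq; [exact: qP|exact: is_poly_cst].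
  - apply: semialg_le; last exact: is_poly_cst.
    by apply: is_poly_sum => i; repeat semialg_step.
  - by apply: semialg_eq; [exact: pP|apply: is_polyM; [|exact: qP]; repeat semialg_step].
  - apply: semialg_eq; last exact: GP.
    by apply: is_polyM; [exact: is_poly_var|apply: is_polyX; exact: qP].
have level_env e : E e <-> at_level (e 0%N) (env_point e) /\
    e 1%N = g (env_point e) ^+ 2.
  have sE : \sum_(i < n) (e i.+2 - xs 0 i) ^+ 2 = enorm (env_point e - xs) ^+ 2.
    by rewrite sqr_enorm; apply: eq_bigr => i _; rewrite !mxE.
  have s1 : (\sum_(i < n) (e i.+2 - xs 0 i) ^+ 2 <= 1) =
      (enorm (env_point e - xs) <= 1).
    by rewrite sE expr_le1 // enorm_ge0.
  rewrite /E /= s1; split.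
    move=> [[/eqP qx x1] [px gx]]; have [_ gE] := GE _ qx; split; last first.
      by apply: (@mulIf _ (polyfun q (env_point e) ^+ 4)); rewrite ?expf_neq0 // gx -gE.
    by split=> //; rewrite /f /ratfun px mulfK.
  move=> [[qx x1 fx] gx]; have [_ gE] := GE _ qx; split; split=> //.
  - exact/eqP.
  - by rewrite -fx /f /ratfun divfK.
  - by rewrite gx -gE.
pose env_of s x := fun i : nat =>
  match i with 0%N => s | 1%N => g x ^+ 2
  | j.+2 => if insub j is Some k then (x : 'rV[R]_n) 0 k else 0 end.
have env_ofK s x : env_point (env_of s x) = x.
  by apply/rowP => i; rewrite mxE /env_of valK.
have E_of s x : at_level s x -> E (env_of s x).
  by move=> sx; apply/level_env; rewrite env_ofK.
pose V s v := exists e, [/\ e 0%N = s, e 1%N = v & E e].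
have VP : semialg (fun e => V (e 0%N) (e 1%N)) by exact: semialg_proj2.
pose A e := E e /\ forall v, V (e 0%N) v -> e 1%N <= 4 * v + e 0%N ^+ 2.
have AP : semialg A.
  apply: semialg_and => //; apply: semialg_forall; apply: semialg_imp.
    by apply: (semialg_subst2 VP); exact: is_poly_var.
  by repeat semialg_step.
have [e i|c [cP cA]] := semialg_curve_selection n.+1 A
    (fun i => if i is j.+1 then (if insub j is Some k then xs 0 k - 1 else 0) else 0) AP.
  move=> [/level_env[[_ x1 _] vx] _]; case: i => [|i].
    by rewrite vx sqr_ge0.
  rewrite ltnS => im; rewrite insubT /=.
  have := coord_le_enorm (env_point e - xs) (Ordinal im).
  rewrite !mxE /= => /le_trans/(_ x1); rewrite ler_norml => /andP[+ _].
  by move=> ?; lra.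
have VE s v : V s v -> exists2 x, at_level s x & v = g x ^+ 2.
  by move=> [e [<- <- /level_env[? ?]]]; exists (env_point e).
exists (c 0%N), (fun i => c i.+1); split=> [||i im|s s0 [x0 sx0]].
- apply: (@semialg_ext _ (fun e => exists v, V (e 0%N) v)) => [e|].
    split=> [[v /VE[x sx _]]|[x sx]]; first by exists x.
    by exists (g x ^+ 2), (env_of (e 0%N) x); split=> //; exact: E_of.
  by apply: semialg_exists; apply: (semialg_subst2 VP); exact: is_poly_var.
- exact: cP.
- exact: cP.
have [|e [es [Ee Amin] ec]] := cA s.
  pose S := [set v | V s v].
  have infS : has_inf S.
    split; first by exists (g x0 ^+ 2), (env_of s x0); split=> //; exact: E_of.
    by exists 0 => v /(VE s)[x _ ->]; exact: sqr_ge0.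
  have s20 : 0 < s ^+ 2 by rewrite exprn_gt0.
  have [_ [e [es <- Ee]] ev] := inf_adherent s20 infS.
  exists e; split=> //; split=> // v; rewrite es => Vv.
  have : inf S <= v by apply: ge_inf => //; case: infS.
  have [x _ vE] := VE s v Vv; have : 0 <= v by rewrite vE sqr_ge0.
  by move=> ? ?; lra.
have xE : env_point e = \row_(i < n) c i.+1 s :> 'rV[R]_n.
  by apply/rowP => i; rewrite !mxE ec // ltnS.
have /level_env[sx vx] := Ee; rewrite xE es (ec 0%N) // in sx vx.
split=> // x sx'; rewrite -(ec 0%N) // -es; apply: Amin.
by exists (env_of s x); split=> //; exact: E_of.
Qed.

(** Near [0+] every coordinate is monotone; [L] is the sum of the coordinates,
    each with the sign that makes it nondecreasing. *)
Lemma eventually_monotone_path (y : nat -> R -> R) :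
  (forall i, (i < n)%N -> semialg (fun e => e 1%N = y i (e 0%N))) ->
  exists r (L : R -> R), 0 < r /\ forall s t, 0 < s -> s <= t -> t < r ->
    norm1 (\row_(i < n) y i t - \row_(i < n) y i s) = L t - L s.
Proof.
move=> yP; have /choice[rb rbP] : forall i : 'I_n, exists rb : R * bool, 0 < rb.1 /\
    forall s t, 0 < s -> s <= t -> t < rb.1 ->
      `|y i t - y i s| = (-1) ^+ rb.2 * (y i t - y i s).
  move=> i; have [r [r0 [inc|dec]]] := semialg_fun_monotone _ (yP i (ltn_ord i)).
    exists (r, false); split=> // s t s0 st tr.
    by rewrite expr0 mul1r ger0_norm // subr_ge0 inc.
  exists (r, true); split=> // s t s0 st tr.
  by rewrite expr1 mulN1r ler0_norm // subr_le0 dec.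
exists (\big[Num.min/1]_(i < n) (rb i).1),
  (fun s => \sum_(i < n) (-1) ^+ (rb i).2 * y i s); split.
  by apply: lt_bigmin => // i _; have [] := rbP i.
move=> s t s0 st tr; rewrite -sumrB; apply: eq_bigr => i _.
rewrite !mxE -mulrBr; apply: (rbP i).2 => //.
by apply: lt_le_trans tr _; apply: bigmin_le_cond.
Qed.

(** If [t] is the value of [f - l] at [gam t], moving along [gam] at slope less
    than [K] costs at least [1 / K] of length per unit of level.  This is
    differentiability of [f] where [gam] is continuous; at a jump of [gam] the
    length gained is bounded below while the change of level is small. *)
Lemma level_gap_le_length (gam : R -> 'rV[R]_n) (L : R -> R) (r K s t : R) :
  (forall u, 0 < u < r -> ratdom q (gam u) /\ f (gam u) = l + u) ->
  (forall u v, 0 < u -> u <= v -> v < r -> norm1 (gam v - gam u) = L v - L u) ->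
  0 < s -> s <= t -> t < r -> (forall u, s <= u <= t -> g (gam u) < K) ->
  t - s <= K * (L t - L s).
Proof.
move=> gamP LP s0 st tr gK.
have K0 : 0 < K by apply: le_lt_trans (gK s _); rewrite ?enorm_ge0 ?lexx.
have loc u : s <= u <= t -> exists d, 0 < d /\ forall v, 0 < v < r ->
    `|v - u| < d -> `|v - u| <= K * norm1 (gam v - gam u).
  move=> ust; have u0r : 0 < u < r.
    by move/andP: ust => [su ut]; rewrite (lt_le_trans s0) // (le_lt_trans ut).
  have [qu fu] := gamP u u0r; have [_ _ /(_ _ qu)[du _]] := ratfun_gradient p q.
  have [eta [eta0 etaP]] := differentiable_norm1_bound _ _ _ du (gK u ust).
  exists (K * eta); split=> [|v vr vu]; first exact: mulr_gt0.
  have [lt_eta|ge_eta] := ltP (norm1 (gam v - gam u)) eta.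
    have := etaP _ lt_eta; rewrite -/f (gamP v vr).2 fu.
    by rewrite opprD addrACA subrr add0r.
  by apply: ltW; apply: lt_le_trans vu _; rewrite ler_pM2l.
suff : K * L s - s <= K * L t - t by move=> ?; lra.
apply: (@locally_nondecreasing _ (fun u => K * L u - u)) st => u /andP[su ut].
  have [|d [d0 dP]] := loc u; first by rewrite su ltW.
  exists (Num.min d (t - u)); rewrite lt_min d0 subr_gt0; split=> // v uv.
  rewrite -ltrBlDl lt_min => /andP[vd vt].
  have vr : v < r by lra.
  have := dP v; rewrite LP //; [|lra..].
  by rewrite gtr0_norm ?subr_gt0 // => /(_ _ vd) h; have := h ltac:(lra); lra.
have [|d [d0 dP]] := loc u; first by rewrite ut ltW.
exists (Num.min d (u - s)); rewrite lt_min d0 subr_gt0; split=> // v.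
rewrite ltrBlDr -ltrBlDl lt_min => /andP[vd vs] vu.
have ur : u < r by lra.
have := dP v; rewrite -[norm1 _]/(norm1 (gam v - gam u)).
have -> : norm1 (gam v - gam u) = norm1 (gam u - gam v).
  by apply: eq_bigr => i _; rewrite !mxE distrC.
rewrite LP //; [|lra..]; rewrite distrC gtr0_norm ?subr_gt0 // => h.
by have := h ltac:(lra) ltac:(lra); lra.
Qed.

Lemma small_oscillation (L : R -> R) (r m d : R) :
  0 < r -> 0 < d -> (forall s t, 0 < s -> s <= t -> t < r -> L s <= L t) ->
  (forall s, 0 < s < r -> m <= L s) ->
  exists r', [/\ 0 < r', r' <= r &
    forall s t, 0 < s -> s <= t -> t < r' -> L t - L s <= d].
Proof.
move=> r0 d0 incL mL; pose B := [set L s | s in [set s | 0 < s < r]].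
have infB : has_inf B.
  split; last by exists m => _ [s /= sr <-]; exact: mL.
  by exists (L (r / 2)), (r / 2) => //=; apply/andP; split; lra.
have [_ [r' /= /andP[r'0 r'r] <-] Lr'] := inf_adherent d0 infB.
exists r'; split=> [//||s t s0 st tr]; first exact: ltW.
have : L t <= L r' by apply: incL; rewrite ?(ltW tr) // (lt_le_trans s0).
have : inf B <= L s.
  by apply: ge_inf; [case: infB|exists s => //=; apply/andP; split; lra].
by move=> ? ?; lra.
Qed.

(** When the slope of the selected curve is nondecreasing, the estimate along
    it holds with [K = 2 * g x + 2 * t]; since the oscillation of [L] near
    [0+] is small this forces [t <= 2 * g x], hence [K <= 6 * g x]. *)
Lemma kurdyka_lojasiewicz : exists r (Lam : R -> R) m, [/\ 0 < r,
  forall s t, 0 < s -> s <= t -> t < r -> Lam s <= Lam t,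
  forall s, 0 < s < r -> m <= Lam s &
  forall x s t, at_level t x -> 0 < s -> s <= t -> t < r ->
    t - s <= g x * (Lam t - Lam s)].
Proof.
have [c [y [NP cP yP cyP]]] := steepest_curve.
pose gam s : 'rV[R]_n := \row_(i < n) y i s.
case: (right_dichotomy (fun s => exists x, at_level s x) NP 0) => -[r [r0]];
    rewrite add0r => rP; last first.
  exists r, (fun=> 0), 0; split=> // x s t tx s0 st tr.
  by exfalso; apply: (rP t); [exact: lt_le_trans st|by []|exists x].
have {rP cyP}gamP s : 0 < s < r -> [/\ at_level s (gam s), c s = g (gam s) ^+ 2 &
    forall x, at_level s x -> c s <= 4 * g x ^+ 2 + s ^+ 2].
  by move=> /andP[s0 sr]; apply: cyP => //; exact: rP.
have [rL [L [rL0 LP]]] := eventually_monotone_path y yP.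
have [rc [rc0 c_mono]] := semialg_fun_monotone _ cP.
pose r1 := Num.min r (Num.min rL rc).
have r10 : 0 < r1 by rewrite !lt_min r0 rL0 rc0.
have r1P s : s < r1 -> [/\ s < r, s < rL & s < rc].
  by rewrite !lt_min => /and3P.
have incL s t : 0 < s -> s <= t -> t < r1 -> L s <= L t.
  move=> s0 st /r1P[_ tL _]; rewrite -subr_ge0 -LP //.
  by apply: sumr_ge0 => i _.
(* Squared slope nonincreasing and positive somewhere; if it is nonincreasing
   but vanishes identically, it is constant and falls under the other case. *)
have [[s0 [s00 s0r1 cs0]]|c0] := pselect (exists s0, [/\ 0 < s0, s0 < r1 &
    (forall s, 0 < s -> s <= s0 -> c s0 <= c s) /\ 0 < c s0]).
  pose k := c s0; pose m := Num.sqrt (k / 8).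
  have k0 : 0 < k by case: cs0.
  have m0 : 0 < m by rewrite sqrtr_gt0 divr_gt0.
  pose r2 := Num.min s0 (Num.min 1 (k / 2)).
  exists r2, (fun s => s / m), 0; split=> [|s t s_gt0 st tr|s /andP[s_gt0 _]|].
  - by rewrite !lt_min s00 ltr01 divr_gt0.
  - by rewrite ler_pM2r // invr_gt0.
  - by rewrite divr_ge0 ?ltW.
  move=> x s t tx s_gt0 st; rewrite !lt_min => /and3P[ts0 t1 tk].
  have t_gt0 : 0 < t by exact: lt_le_trans st.
  have [tr _ _] := r1P t (lt_trans ts0 s0r1).
  have [|_ _ /(_ x tx) ctx] := gamP t; first by rewrite t_gt0.
  have kct : k <= c t by apply: cs0.1 => //; exact: ltW.
  have t2 : t ^+ 2 <= t by rewrite expr2 ger_pMl // ltW.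
  have mg : m <= g x.
    rewrite -(ler_pXn2r (n := 2)) ?nnegrE ?enorm_ge0 ?ltW // sqr_sqrtr; last first.
      by rewrite divr_ge0 // ltW.
    by lra.
  rewrite -mulrBl mulrCA -[leLHS]mulr1 ler_wpM2l ?subr_ge0 //.
  by rewrite ler_pdivlMr // mul1r.
have {c_mono c0}incc s t : 0 < s -> s <= t -> t < r1 -> c s <= c t.
  case: c_mono => [inc|dec] s_gt0 st tr1.
    by apply: inc => //; have [] := r1P t tr1.
  have cE u : 0 < u -> u < r1 -> c u = 0.
    move=> u0 ur1; have [ur _ urc] := r1P u ur1.
    apply/eqP; rewrite eq_le; apply/andP; split.
      rewrite leNgt; apply/negP => cu; apply: c0; exists u; split=> //.
      by split=> // v v0 vu; exact: dec.
    by have [|_ -> _] := gamP u; rewrite ?u0 // sqr_ge0.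
  by rewrite !cE // ?(lt_le_trans s_gt0) ?(le_lt_trans st).
have Lm s : 0 < s < r1 -> L (r1 / 2) - 2 *+ n <= L s.
  move=> /andP[s_gt0 sr1].
  have near_xs u : 0 < u < r1 -> forall i, `|gam u 0 i - xs 0 i| <= 1.
    move=> /andP[u0 /r1P[ur _ _]] i.
    have [|[_ h _] _ _] := gamP u; first by rewrite u0.
    by apply: le_trans h; have := coord_le_enorm (gam u - xs) i; rewrite !mxE.
  have [hs|hs] := leP (r1 / 2) s.
    have : L (r1 / 2) <= L s by apply: incL => //; lra.
    by apply: le_trans; rewrite gerBl mulrn_wge0.
  rewrite lerBlDl -lerBlDr -LP ?(ltW hs) //; last first.
    by have [//|] := r1P (r1 / 2); lra.
  rewrite -[leRHS](_ : \sum_(i < n) (2 : R) = _); last first.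
    by rewrite sumr_const card_ord.
  apply: ler_sum => i _; rewrite !mxE.
  have h1 := near_xs (r1 / 2) ltac:(apply/andP; split; lra) i.
  have h2 := near_xs s ltac:(apply/andP; split; lra) i.
  move: h1 h2; rewrite !mxE !ler_norml => /andP[? ?] /andP[? ?].
  by apply/andP; split; lra.
have r1R : r1 <= r by rewrite ge_min lexx.
have [r2 [r20 r21 osc]] := small_oscillation L r1 _ (1 / 4) r10 ltac:(lra) incL Lm.
have gap x s t : at_level t x -> 0 < s -> s <= t -> t < r2 ->
    t - s <= (2 * g x + 2 * t) * (L t - L s).
  move=> tx s_gt0 st tr2; have tr1 : t < r1 by exact: lt_le_trans r21.
  have gx0 : 0 <= g x by exact: enorm_ge0.
  apply: (@level_gap_le_length gam L r1) => // [u|u v u0 uv vr1|u /andP[su ut]].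
  - move=> /andP[u0 ur1]; have [|[] //] := gamP u.
    by rewrite u0 (lt_le_trans ur1).
  - by apply: LP => //; have [] := r1P v vr1.
  have u0 : 0 < u by exact: lt_le_trans su.
  have ur : u < r by lra.
  have [|_ cu _] := gamP u; first by rewrite u0.
  have [|_ _ /(_ x tx) ct] := gamP t; first by apply/andP; split; lra.
  rewrite -(ltr_pXn2r (n := 2)) ?nnegrE ?enorm_ge0 //; last by lra.
  rewrite -cu (le_lt_trans (incc u t _ _ _)) // (le_lt_trans ct) //.
  have t20 : 0 < t ^+ 2 by rewrite exprn_gt0 // (lt_le_trans u0).
  have gt : 0 <= g x * t by rewrite mulr_ge0 // ltW // (lt_le_trans u0).
  rewrite -subr_gt0; have -> : (2 * g x + 2 * t) ^+ 2 - (4 * g x ^+ 2 + t ^+ 2) =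
    8 * (g x * t) + 3 * t ^+ 2 by ring.
  lra.
exists r2, (fun s => 6 * L s), (6 * (L (r1 / 2) - 2 *+ n)); split=> //.
- by move=> s t s0 st tr; rewrite ler_pM2l // incL // (lt_le_trans tr).
- by move=> s /andP[s0 sr]; rewrite ler_pM2l // Lm // s0 (lt_le_trans sr).
move=> x s t tx s_gt0 st tr2; have t0 : 0 < t by exact: lt_le_trans st.
(* For [s = t / 4] the bound [1 / 4] on [L t - L s] makes the term in [2 * t]
   smaller than [t - s]. *)
have tg : t / 2 <= g x.
  have h := gap x (t / 4) t tx ltac:(lra) ltac:(lra) tr2.
  have o := osc (t / 4) t ltac:(lra) ltac:(lra) tr2.
  have K0 : 0 <= 2 * g x + 2 * t.
    by rewrite addr_ge0 // mulr_ge0 // ?enorm_ge0 // ltW.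
  have := ler_wpM2l K0 o; lra.
apply: (le_trans (gap x s t tx s_gt0 st tr2)).
rewrite -mulrBr mulrA ler_wpM2r //.
  by rewrite subr_ge0 incL // (lt_le_trans tr2).
by lra.
Qed.

End KurdykaLojasiewicz.

(** * Convergence of the descent sequence *)

Lemma enorm_le_norm {R : realType} {n : nat} (x : 'rV[R]_n) :
  enorm x <= n.+1%:R * `|x|.
Proof.
rewrite -(ler_pXn2r (n := 2)) ?nnegrE ?enorm_ge0 ?mulr_ge0 // sqr_enorm.
have nx i : x 0 i ^+ 2 <= `|x| ^+ 2.
  rewrite -[leLHS]real_normK ?num_real // lerXn2r ?nnegrE // [`|x|]mx_normrE.
  exact: (le_bigmax _ (fun ij : 'I_1 * 'I_n => `|x ij.1 ij.2|) (0, i)).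
apply: (@le_trans _ _ (\sum_(i < n) `|x| ^+ 2)); first exact: ler_sum.
rewrite sumr_const card_ord exprMn -[leLHS]mulr_natl ler_wpM2r ?sqr_ge0 //.
by rewrite -natrX ler_nat (leq_trans (leqnSn n)) // -mulnn leq_pmulr.
Qed.

Lemma norm_le_enorm {R : realType} {n : nat} (x : 'rV[R]_n) : `|x| <= enorm x.
Proof.
rewrite [`|x|]mx_normrE; apply/bigmax_leP; split=> [|[i j] _ /=].
  exact: enorm_ge0.
by rewrite (ord1 i); exact: coord_le_enorm.
Qed.

Theorem theorem2p11 (R : realType) (n : nat) (p q : mpoly.mpoly n R)
  (q_neq0 : exists x : 'rV[R]_n, polyfun q x != 0)
  (f_bounded : [bounded ratfun p q x | x in ratdom q])
  (x_ : nat -> 'rV[R]_n) (x_dom : forall k : nat, ratdom q (x_ k))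
  (xs : 'rV[R]_n) (xs_cluster : cluster (x_ @ \oo) xs)
  (descent : exists2 sigma : R, 0 < sigma &
     \forall k \near \oo,
       ratfun p q (x_ k) - ratfun p q (x_ k.+1) >=
         sigma * enorm (gradient (ratfun p q) (x_ k))
               * enorm (x_ k.+1 - x_ k))
  (stationary : \forall k \near \oo,
     ratfun p q (x_ k) = ratfun p q (x_ k.+1) -> x_ k = x_ k.+1)
  (directions : direction_cluster xs x_ `<=` Oset q xs) :
  x_ @ \oo --> xs.
Proof.
have [sigma sigma0 descN] := descent.
have [N _ NP] : \forall k \near \oo,
    sigma * enorm (gradient (ratfun p q) (x_ k)) * enorm (x_ k.+1 - x_ k) <=
      ratfun p q (x_ k) - ratfun p q (x_ k.+1) /\
    (ratfun p q (x_ k) = ratfun p q (x_ k.+1) -> x_ k = x_ k.+1).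
  by apply: filterS2 descN stationary.
pose a k := ratfun p q (x_ k).
have dec k : (N <= k)%N -> a k.+1 <= a k.
  move=> /NP[h _]; rewrite -subr_ge0; apply: le_trans h.
  by rewrite !mulr_ge0 ?enorm_ge0 // ltW.
have decn k j : (N <= k)%N -> a (k + j)%N <= a k.
  move=> Nk; elim: j => [|j IHj]; first by rewrite addn0.
  by rewrite addnS; apply: le_trans IHj; apply: dec; rewrite (leq_trans Nk) ?leq_addr.
have [M [_ /(_ (M + 1))]] := f_bounded; rewrite ltrDl ltr01 => /(_ isT) fM.
pose B := [set a k | k in [set k | (N <= k)%N]].
have infB : has_inf B.
  split; first by exists (a N), N => /=.
  exists (- (M + 1)) => _ [k _ <-].
  by have /= := fM _ (x_dom k); rewrite ler_norml => /andP[].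
pose l := inf B; pose s k := a k - l.
have s_ge0 k : (N <= k)%N -> 0 <= s k.
  by move=> Nk; rewrite subr_ge0; apply: ge_inf; [case: infB|exists k].
have s_to0 d : 0 < d -> exists2 K, (N <= K)%N & forall k, (K <= k)%N -> s k < d.
  move=> d0; have [_ [K /= NK <-] aK] := inf_adherent d0 infB.
  exists K => // k Kk; rewrite /s ltrBlDl.
  by apply: le_lt_trans aK; rewrite -(subnKC Kk) decn.
have often d K : 0 < d -> exists2 k, (K <= k)%N & `|x_ k - xs| < d.
  move=> d0; have [||_ [[k /= Kk <-]]] :=
    xs_cluster (x_ @` [set k | (K <= k)%N]) (ball xs d).
  - by exists K => // k Kk; exists k.
  - exact: nbhsx_ballx.
  by rewrite mx_norm_ball /ball_ /= distrC; exists k.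
apply/cvgrPdist_lt => eps0 eps00.
(* A ball of radius [1 / (n + 1)] for the ambient norm lies in the Euclidean
   unit ball, where the Kurdyka-Lojasiewicz inequality is available. *)
pose eps := Num.min eps0 (n.+1%:R^-1); have eps_gt0 : 0 < eps.
  by rewrite lt_min eps00 invr_gt0 ltr0Sn.
suff [K KP] : exists K, forall k, (K <= k)%N -> `|x_ k - xs| < eps.
  exists K => // k /KP; rewrite /= distrC lt_min => /andP[] //.
(* If the limit value is attained, the sequence is eventually constant. *)
have [[k Nk sk]|s_neq0] := pselect (exists2 k, (N <= k)%N & s k = 0).
  have xk j : x_ (k + j)%N = x_ k.
    elim: j => [|j IHj]; first by rewrite addn0.
    rewrite addnS -IHj; apply/esym; apply: (NP (k + j)%N _).2.
      by rewrite /= (leq_trans Nk) ?leq_addr.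
    have al i : a (k + i)%N = l.
      apply/eqP; rewrite -subr_eq0 eq_le s_ge0 ?(leq_trans Nk) ?leq_addr //.
      by rewrite andbT -sk lerD2r decn.
    by have := al j.+1; rewrite addnS -(al j).
  exists k => j kj; have [i ki xi] := often eps k eps_gt0.
  by rewrite -(subnKC kj) xk -(xk (i - k)%N) subnKC.
have s_gt0 k : (N <= k)%N -> 0 < s k.
  move=> Nk; rewrite lt_neqAle s_ge0 // andbT eq_sym; apply/eqP => sk.
  by apply: s_neq0; exists k.
have [r [Lam [m [r0 incL mL KL]]]] := kurdyka_lojasiewicz p q xs l.
have d0 : 0 < sigma * (eps / 3) by rewrite mulr_gt0 // divr_gt0.
have [r' [r'0 r'r osc]] := small_oscillation Lam r m _ r0 d0 incL mL.
have [K0 NK0 sK0] := s_to0 r' r'0.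
have [K K0K xK] := often (eps / 3) K0 ltac:(lra).
have NK : (N <= K)%N by exact: leq_trans K0K.
have decs k j : (N <= k)%N -> s (k + j)%N <= s k by move=> Nk; rewrite lerD2r decn.
exists K => k Kk; rewrite -(subnKC Kk); move: (k - K)%N => {k Kk} j.
suff path_le : `|x_ (K + j)%N - xs| <=
    `|x_ K - xs| + (Lam (s K) - Lam (s (K + j)%N)) / sigma.
  have := osc (s (K + j)%N) (s K) (s_gt0 _ _) (decs _ _ NK) (sK0 _ K0K).
  rewrite (leq_trans NK) ?leq_addr // => /(_ isT).
  rewrite -ler_pdivrMl // mulrC; lra.
elim: j => [|j IHj]; first by rewrite addn0 subrr mul0r addr0.
set i := (K + j)%N in IHj *; rewrite addnS -/i.
have Ni : (N <= i)%N by rewrite (leq_trans NK) ?leq_addr.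
have oscK : (Lam (s K) - Lam (s i)) / sigma <= eps / 3.
  rewrite ler_pdivrMr // mulrC; apply: osc; [exact: s_gt0|exact: decs|exact: sK0].
have in_ball : at_level p q xs l (s i) (x_ i).
  split=> //; last by rewrite /s addrCA subrr addr0.
  apply: le_trans (enorm_le_norm _) _; rewrite -ler_pdivlMl ?ltr0Sn // mulr1.
  have : eps <= n.+1%:R^-1 by rewrite ge_min lexx orbT.
  by apply: le_trans; clear - IHj oscK xK eps_gt0; lra.
have step : `|x_ i.+1 - x_ i| <= (Lam (s i) - Lam (s i.+1)) / sigma.
  have [h stat] := NP i Ni.
  have [aE|a_neq] := eqVneq (a i) (a i.+1).
    by rewrite -(stat aE) /s aE !subrr normr0 mul0r.
  have gap : 0 < a i - a i.+1 by rewrite subr_gt0 lt_neqAle eq_sym a_neq dec.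
  have si1 : s i.+1 <= s i by rewrite lerD2r dec.
  have sir : s i < r by apply: lt_le_trans r'r; apply: sK0; rewrite (leq_trans K0K) ?leq_addr.
  have := KL _ _ _ in_ball (s_gt0 _ (leqW Ni)) si1 sir.
  have -> : s i - s i.+1 = a i - a i.+1 by rewrite /s; ring.
  move=> kl; have g0 : 0 < enorm (gradient (ratfun p q) (x_ i)).
    rewrite lt_neqAle enorm_ge0 andbT; apply/eqP => g0.
    by move: kl; rewrite -g0 mul0r leNgt gap.
  rewrite ler_pdivlMr // mulrC -(ler_pM2l g0).
  apply: le_trans kl; apply: le_trans h; rewrite mulrCA mulrA.
  by rewrite ler_wpM2l ?norm_le_enorm // mulr_ge0 // ltW.
rewrite -[x_ i.+1](subrK (x_ i)) -addrA (le_trans (ler_normD _ _)) //.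
have -> : (Lam (s K) - Lam (s i.+1)) / sigma =
  (Lam (s K) - Lam (s i)) / sigma + (Lam (s i) - Lam (s i.+1)) / sigma.
  by rewrite -mulrDl; congr (_ / _); ring.
by lra.
Qed.
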